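(* Let $(N_1,C_1)$ and $(N_2,C_2)$ be coherent nets and $E$ a Presburger formula with free variables in $P_1\cup P_2$, and suppose $(N_1,C_1)\approxeq_E(N_2,C_2)$. Let $a,b\in\Sigma$. Writing $T^-_i(a)$ and $T^+_i(a,b)$ for the operations $T^-(a)$ and $T^+(a,b)$ applied to $N_i$, we have: (1) for $i=1,2$, $(T^-_i(a),C_i)$ and $(T^+_i(a,b),C_i)$ are coherent nets; (2) $(T^-_1(a),C_1)\approxeq_E(T^-_2(a),C_2)$; (3) $(T^+_1(a,b),C_1)\approxeq_E(T^+_2(a,b),C_2)$.
   Context: A labeled Petri net $N=(P,T,\mathrm{Pre},\mathrm{Post})$ has finite place set $P$, finite transition set $T$, $\mathrm{Pre},\mathrm{Post}:T\to(P\to\mathbb N)$ and labeling $l:T\to\Sigma\cup\{\tau\}$ with $\tau\notin\Sigma$ silent. A marking is $m:P\to\mathbb N$. $t$ is enabled at $m$ if $m(p)\ge\mathrm{Pre}(t,p)$ for all $p$, and then $m\xrightarrow{t}m'$ with $m'=m-\mathrm{Pre}(t)+\mathrm{Post}(t)$; $m\xRightarrow{\varrho}m'$ is firing along $\varrho\in T^*$. Extend $l$ to $T^*$ by erasing $\tau$. For $\sigma\in\Sigma^*$, $m\xRightarrow{\sigma}m'$ means some $\varrho$ with $l(\varrho)=\sigma$ has $m\xRightarrow{\varrho}m'$ ($m\xRightarrow{\epsilon}m'$: reachability using only silent transitions). $m\overset{\epsilon}{\twoheadrightarrow}m'$ iff $m=m'$; for $\sigma\in\Sigma^*,c\in\Sigma$,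 $m\overset{\sigma c}{\twoheadrightarrow}m'$ iff there exist $m''$, $t$ with $l(t)=c$ and $m\xRightarrow{\sigma}m''\xrightarrow{t}m'$. For a Presburger formula $C$ over the places of $N$, $(N,C)$ is a coherent net if for every $m\models C$, $\sigma\in\Sigma^*$, $m\xRightarrow{\sigma}m'$ there is $m''\models C$ with $m\overset{\sigma}{\twoheadrightarrow}m''$ and $m''\xRightarrow{\epsilon}m'$. For markings $m_1\in\mathbb N^{P_1}$, $m_2\in\mathbb N^{P_2}$ (place sets may share places): $m_1\equiv_E m_2$ means they agree on $P_1\cap P_2$ and $m_1\cup m_2$ satisfies $E$ over $\mathbb N$; $m_1\langle C_1EC_2\rangle m_2$ means $m_1\models C_1$, $m_1\equiv_E m_2$, $m_2\models C_2$. $(N_1,C_1)\preceq_E(N_2,C_2)$ means: (S1) for every $m_1\models C_1$ there is $m_2$ with $m_1\langle C_1EC_2\rangle m_2$; (S2) for all $m_1\xRightarrow{\epsilon}m_1'$ in $N_1$ and all $m_2$, $m_1\equiv_E m_2$ implies $m_1'\equiv_E m_2$; (S3) for all $\sigma\in\Sigma^*$, $m_1\xRightarrow{\sigma}m_1'$ in $N_1$ and $m_2,m_2'$ with $m_1\langle C_1EC_2\rangle m_2$ and $m_1'\equiv_E m_2'$, we have $m_2\xRightarrow{\sigma}m_2'$ in $N_2$. $(N_1,C_1)\approxeq_E(N_2,C_2)$ means $(N_1,C_1)\preceq_E(N_2,C_2)$ and $(N_2,C_2)\preceq_E(N_1,C_1)$. Transition operations on a net $N=(P,T,\mathrm{Pre},\mathrm{Post})$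 with labeling $l$, for $a,b\in\Sigma$: $T^-(a)$ is the net $(P,T',\mathrm{Pre}',\mathrm{Post}')$ with $T'=T\setminus l^{-1}(a)$ and $\mathrm{Pre}',\mathrm{Post}',l$ restricted to $T'$ (it removes all transitions labeled $a$). $T^+(a,b)$ is the net $(P,T',\mathrm{Pre}',\mathrm{Post}')$ with $T'=(T\times\{0\})\cup(l^{-1}(a)\times\{1\})$, $\mathrm{Pre}'(t,i)=\mathrm{Pre}(t)$, $\mathrm{Post}'(t,i)=\mathrm{Post}(t)$, and labeling $l'(t,0)=l(t)$, $l'(t,1)=b$ (it duplicates every transition labeled $a$, labeling the copy $b$). *)

(* Defs.v *)
From HB Require Import structures.
From mathcomp Require Import all_boot finmap.

Set Implicit Arguments.
Unset Strict Implicit.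
Unset Printing Implicit Defensive.

Local Open Scope fset_scope.

(** Presburger arithmetic: first-order formulas of (nat, 0, 1, +, <=), with free
    and bound variables named by [V]. *)

Section Presburger.
Variable V : choiceType.

Inductive pterm : Type :=
| PVar of V
| PConst of nat
| PAdd of pterm & pterm.

Inductive pform : Type :=
| PEq of pterm & pterm
| PLe of pterm & pterm
| PNot of pform
| PAnd of pform & pform
| POr of pform & pform
| PEx of V & pform
| PAll of V & pform.

Fixpoint tvars (t : pterm) : {fset V} :=
  match t with
  | PVar x => [fset x]
  | PConst _ => fset0
  | PAdd t1 t2 => tvars t1 `|` tvars t2
  end.

Fixpoint fvars (f : pform) : {fset V} :=
  match f with
  | PEq t1 t2 | PLe t1 t2 => tvars t1 `|` tvars t2
  | PNot f1 => fvars f1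
  | PAnd f1 f2 | POr f1 f2 => fvars f1 `|` fvars f2
  | PEx x f1 | PAll x f1 => fvars f1 `\ x
  end.

Fixpoint teval (v : V -> nat) (t : pterm) : nat :=
  match t with
  | PVar x => v x
  | PConst n => n
  | PAdd t1 t2 => (teval v t1 + teval v t2)%N
  end.

Definition update (v : V -> nat) (x : V) (n : nat) : V -> nat :=
  fun y => if y == x then n else v y.

Fixpoint holds (v : V -> nat) (f : pform) : Prop :=
  match f with
  | PEq t1 t2 => teval v t1 = teval v t2
  | PLe t1 t2 => (teval v t1 <= teval v t2)%N
  | PNot f1 => ~ holds v f1
  | PAnd f1 f2 => holds v f1 /\ holds v f2
  | POr f1 f2 => holds v f1 \/ holds v f2
  | PEx x f1 => exists n, holds (update v x n) f1
  | PAll x f1 => forall n, holds (update v x n) f1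
  end.

End Presburger.

(** Place sets are finite subsets of a common type of names [V], so that two
    nets may share places.  The silent label tau is [None]. *)

Definition marking (V : choiceType) (P : {fset V}) := {ffun P -> nat}.

Record lnet (V : choiceType) (Sigma : eqType) := LNet {
  places : {fset V};
  trans : finType;
  pre : trans -> marking places;
  post : trans -> marking places;
  lab : trans -> option Sigma
}.

Section Firing.
Variables (V : choiceType) (Sigma : eqType) (N : lnet V Sigma).
Implicit Types (m : marking (places N)) (t : trans N).

Definition enabled m t : Prop := forall p, (pre t p <= m p)%N.

Definition step m t m' : Prop :=
  enabled m t /\ m' = [ffun p => (m p - pre t p + post t p)%N].

Fixpoint fire m (rho : seq (trans N)) m' : Prop :=
  match rho with
  | [::] => m = m'
  | t :: rho' => exists m'', step m t m'' /\ fire m'' rho' m'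
  end.

(* [pmap] drops the transitions whose label is [None]. *)
Definition labels (rho : seq (trans N)) : seq Sigma := pmap (@lab V Sigma N) rho.

Definition reach m (sigma : seq Sigma) m' : Prop :=
  exists rho, labels rho = sigma /\ fire m rho m'.

(* [treach m sigma m'] is the double-headed arrow: [reach] ending with the
   transition that carries the last letter of [sigma]. *)
Inductive treach m : seq Sigma -> marking (places N) -> Prop :=
| treach_nil : treach m [::] m
| treach_rcons sigma c m'' t m' :
    reach m sigma m'' -> lab t = Some c -> step m'' t m' ->
    treach m (rcons sigma c) m'.

End Firing.

(* The value 0 off [P] is irrelevant for formulas whose free variables are in
   [P]; likewise for [valuation2]. *)
Definition valuation (V : choiceType) (P : {fset V}) (m : marking P) : V -> nat :=
  fun x => if (insub x : option P) is Some p then m p else 0.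

Definition models (V : choiceType) (P : {fset V}) (m : marking P)
  (C : pform V) : Prop := holds (valuation m) C.

Definition coherent (V : choiceType) (Sigma : eqType) (N : lnet V Sigma)
  (C : pform V) : Prop :=
  fvars C `<=` places N /\
  forall (m : marking (places N)) (sigma : seq Sigma) (m' : marking (places N)),
    models m C -> reach m sigma m' ->
    exists m'', [/\ models m'' C, treach m sigma m'' & reach m'' [::] m'].

Section Equivalence.
Variable V : choiceType.

Definition agree (P1 P2 : {fset V}) (m1 : marking P1) (m2 : marking P2) : Prop :=
  forall (p : V) (p1 : p \in P1) (p2 : p \in P2), m1 [` p1] = m2 [` p2].

(* The marking m1 \cup m2; symmetric in its arguments when [agree m1 m2]. *)
Definition valuation2 (P1 P2 : {fset V}) (m1 : marking P1) (m2 : marking P2) :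
    V -> nat :=
  fun x => if (insub x : option P1) is Some p then m1 p else valuation m2 x.

Definition equivE (E : pform V) (P1 P2 : {fset V})
    (m1 : marking P1) (m2 : marking P2) : Prop :=
  agree m1 m2 /\ holds (valuation2 m1 m2) E.

Definition linked (C1 E C2 : pform V) (P1 P2 : {fset V})
    (m1 : marking P1) (m2 : marking P2) : Prop :=
  [/\ models m1 C1, equivE E m1 m2 & models m2 C2].

Variable Sigma : eqType.

Definition abstracts (E : pform V) (N1 : lnet V Sigma) (C1 : pform V)
    (N2 : lnet V Sigma) (C2 : pform V) : Prop :=
  [/\ forall m1 : marking (places N1), models m1 C1 ->
        exists m2 : marking (places N2), linked C1 E C2 m1 m2,
      forall (m1 m1' : marking (places N1)) (m2 : marking (places N2)),
        reach m1 [::] m1' -> equivE E m1 m2 -> equivE E m1' m2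
    & forall (sigma : seq Sigma) (m1 m1' : marking (places N1))
             (m2 m2' : marking (places N2)),
        reach m1 sigma m1' -> linked C1 E C2 m1 m2 -> equivE E m1' m2' ->
        reach m2 sigma m2'].

Definition net_equiv (E : pform V) (N1 : lnet V Sigma) (C1 : pform V)
    (N2 : lnet V Sigma) (C2 : pform V) : Prop :=
  abstracts E N1 C1 N2 C2 /\ abstracts E N2 C2 N1 C1.

End Equivalence.

Section Operations.
Variables (V : choiceType) (Sigma : eqType) (N : lnet V Sigma).

Definition Tminus (a : Sigma) : lnet V Sigma :=
  @LNet V Sigma (places N) {t : trans N | lab t != Some a}
    (fun t => pre (val t)) (fun t => post (val t)) (fun t => lab (val t)).

(* T' = (T x {0}) \cup (l^-1(a) x {1}), with [false] for 0 and [true] for 1. *)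
Definition Tplus (a b : Sigma) : lnet V Sigma :=
  @LNet V Sigma (places N)
    {ti : trans N * bool | ti.2 ==> (lab ti.1 == Some a)}
    (fun ti => pre (val ti).1) (fun ti => post (val ti).1)
    (fun ti => if (val ti).2 then Some b else lab (val ti).1).

End Operations.

(* Main.v *)
Require Import Defs.
From HB Require Import structures.
From mathcomp Require Import all_boot finmap.

(** Both operations only act on the labels.  There is a relation [R] on letters,
    depending on [a] and [b] but not on the net, such that the new net has a copy
    of [t] labeled [d] exactly when [R c d] for the label [c] of [t], and keeps
    the silent transitions.  Hence a word [w] leads from [m] to [m'] in the new
    net iff some word letterwise [R]-related to [w] does so in the old one, and
    coherence and equivalence transfer word by word. *)

Set Implicit Arguments.
Unset Strict Implicit.
Unset Printing Implicit Defensive.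

Local Open Scope fset_scope.

(** [Tminus] and [Tplus] are convertible to instances of this, so lemmas about it apply to them
    without any rewriting. *)
Definition relabel (V : choiceType) (Sigma : eqType) (N : lnet V Sigma)
    (T : finType) (f : T -> trans N) (l : T -> option Sigma) : lnet V Sigma :=
  @LNet V Sigma (places N) T (fun t => pre (f t)) (fun t => post (f t)) l.

Definition option_rel (S : Type) (R : rel S) : rel (option S) := fun o o' =>
  match o, o' with
  | None, None => true
  | Some c, Some d => R c d
  | _, _ => false
  end.

Definition relabel_by (V : choiceType) (Sigma : eqType) (N : lnet V Sigma)
    (T : finType) (f : T -> trans N) (l : T -> option Sigma) (R : rel Sigma) :=
  forall t o, (exists2 t', f t' = t & l t' = o) <-> option_rel R (lab t) o.

Section Relabel.
Variables (V : choiceType) (Sigma : eqType) (N : lnet V Sigma).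
Variables (T : finType) (f : T -> trans N) (l : T -> option Sigma).
Variable R : rel Sigma.
Hypothesis fR : relabel_by f l R.

Let N' := relabel f l.

(** Copies have the arcs of their originals, so a run maps forward through [f]; backward, each
    transition is replaced by a copy whose label is the one prescribed by [w]. *)
Lemma reach_relabel (m m' : marking (places N)) w :
  @reach V Sigma N' m w m' <-> exists2 s, all2 R s w & @reach V Sigma N m s m'.
Proof.
split=> [[rho [<- {w}]]|[s sw [rho [rho_s fire_m]]]].
  elim: rho m => [|t rho IH] m /=.
    by move=> ->; exists [::] => //; exists [::].
  case=> m1 [step_m /IH[s sw [rho1 [rho1s fire1]]]].
  (* As its own witness, [t] shows that the labels of [f t] and [t] are related; the mixed
     silent/visible cases then vanish. *)
  have := (fR (f t) (l t)).1 (ex_intro2 _ _ t erefl erefl).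
  case lab_t: (lab (f t)) => [c|]; case: (l t) => [d|] //= Rcd.
    exists (c :: s); first by rewrite /= Rcd.
    exists (f t :: rho1); split; first by rewrite /labels /= lab_t -rho1s.
    by exists m1.
  exists s => //; exists (f t :: rho1); split; last by exists m1.
  by rewrite /labels /= lab_t -rho1s.
elim: rho m s w rho_s sw fire_m => [|t rho IH] m s w.
  by move=> <-; case: w => // _ /= ->; exists [::].
move=> <- {s}; rewrite /labels /=.
case lab_t: (lab t) => [c|] /= + [m1 [step_m fire1]].
  case: w => [|d w] //= /andP[Rcd sw].
  have [|t' ft' lt'] := (fR t (Some d)).2; first by rewrite lab_t.
  have [rho1 [rho1w fire2]] := IH _ _ _ erefl sw fire1.
  exists (t' :: rho1); split; first by rewrite /labels /= lt' -rho1w.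
  by exists m1; split=> //; rewrite -ft' in step_m.
move=> sw; have [|t' ft' lt'] := (fR t None).2; first by rewrite lab_t.
have [rho1 [rho1w fire2]] := IH _ _ _ erefl sw fire1.
exists (t' :: rho1); split; first by rewrite /labels /= lt' -rho1w.
by exists m1; split=> //; rewrite -ft' in step_m.
Qed.

Lemma reach_relabel_nil (m m' : marking (places N)) :
  @reach V Sigma N' m [::] m' <-> @reach V Sigma N m [::] m'.
Proof.
(* Only the empty word is letterwise related to the empty word. *)
rewrite reach_relabel; split=> [[[|//]]|] //.
by exists [::].
Qed.

Lemma treach_relabel (m m' : marking (places N)) s w :
  all2 R s w -> @treach V Sigma N m s m' -> @treach V Sigma N' m w m'.
Proof.
move=> + tr; case: tr w => [[]// _|{}s c m1 t {}m' reach_m1 lab_t step_m1].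
  exact: treach_nil.
(* [treach] singles out the last letter while [all2] unfolds from the first, so [w] is split at its
   end and [all2] is read through [zip]. *)
elim/last_ind => [|w d _]; first by rewrite all2E size_rcons.
rewrite all2E !size_rcons eqSS => /andP[/eqP size_sw].
rewrite zip_rcons // all_rcons /= => /andP[Rcd sw].
have [|t' ft' lt'] := (fR t (Some d)).2; first by rewrite lab_t.
rewrite -ft' in step_m1.
apply: (@treach_rcons _ _ N' _ _ _ m1 t') => //.
by apply/reach_relabel; exists s => //; rewrite all2E size_sw eqxx.
Qed.

(** The intermediate marking that [N] provides for a related word [s] also serves for [w]. *)
Lemma coherent_relabel C : coherent N C -> coherent N' C.
Proof.
case=> fvC coh; split=> // m w m' mC /reach_relabel[s sw /(coh _ _ _ mC)].
case=> m1 [m1C tr_m1 re_m1]; exists m1; split=> //.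
- exact: treach_relabel sw tr_m1.
- exact/reach_relabel_nil.
Qed.

End Relabel.

Section RelabelEquiv.
Variables (V : choiceType) (Sigma : eqType) (R : rel Sigma) (E : pform V).

(** Sharing [R] is essential: the word [s] found for [w] in [N1] is simulated in [N2] and turned
    back into the same [w]. S1 involves no firing, and S2 only silent runs. *)
Lemma abstracts_relabel (N1 N2 : lnet V Sigma) (C1 C2 : pform V)
    (T1 T2 : finType) (f1 : T1 -> trans N1) (f2 : T2 -> trans N2)
    (l1 : T1 -> option Sigma) (l2 : T2 -> option Sigma) :
  relabel_by f1 l1 R -> relabel_by f2 l2 R ->
  abstracts E N1 C1 N2 C2 -> abstracts E (relabel f1 l1) C1 (relabel f2 l2) C2.
Proof.
move=> fR1 fR2 [S1 S2 S3]; split=> [//|m1 m1' m2|w m1 m1' m2 m2'].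
  by move=> /(reach_relabel_nil fR1); apply: S2.
move=> /(reach_relabel fR1)[s sw reach1] m12 m12'.
by apply/(reach_relabel fR2); exists s => //; apply: S3 reach1 m12 m12'.
Qed.

Lemma net_equiv_relabel (N1 N2 : lnet V Sigma) (C1 C2 : pform V)
    (T1 T2 : finType) (f1 : T1 -> trans N1) (f2 : T2 -> trans N2)
    (l1 : T1 -> option Sigma) (l2 : T2 -> option Sigma) :
  relabel_by f1 l1 R -> relabel_by f2 l2 R ->
  net_equiv E N1 C1 N2 C2 -> net_equiv E (relabel f1 l1) C1 (relabel f2 l2) C2.
Proof. by move=> fR1 fR2 [N12 N21]; split; apply: abstracts_relabel. Qed.

End RelabelEquiv.

Section Operations.
Variables (V : choiceType) (Sigma : eqType) (N : lnet V Sigma) (a b : Sigma).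

Definition minus_rel : rel Sigma := fun c d => (c == d) && (c != a).

Definition plus_rel : rel Sigma :=
  fun c d => (c == d) || (c == a) && (d == b).

Lemma Tminus_relabel_by :
  @relabel_by V Sigma N (trans (Tminus N a)) val (@lab V Sigma (Tminus N a))
    minus_rel.
Proof.
move=> t o; split=> [[[t' /= nt'a] <- <-]|].
  by case: (lab t') nt'a => //= c ca; rewrite /minus_rel eqxx.
case lab_t: (lab t) => [c|]; case: o => [d|] //=.
  case/andP=> /eqP<- ca.
  have ta : lab t != Some a by rewrite lab_t.
  by exists (exist _ t ta).
have ta : lab t != Some a by rewrite lab_t.
by exists (exist _ t ta).
Qed.

Lemma Tplus_relabel_by :
  @relabel_by V Sigma N (trans (Tplus N a b)) (fun ti => (val ti).1)
    (@lab V Sigma (Tplus N a b)) plus_rel.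
Proof.
move=> t o; split=> [[[[t' i] /= it'a] <- <-]|].
  case: i it'a => [/eqP-> /=|_ /=]; first by rewrite /plus_rel !eqxx orbT.
  by case: (lab t') => //= c; rewrite /plus_rel eqxx.
have copy0 : (t, false).2 ==> (lab (t, false).1 == Some a) by [].
case lab_t: (lab t) => [c|]; case: o => [d|] //=; last first.
  by exists (exist _ (t, false) copy0).
(* The two disjuncts of [plus_rel] correspond to the original, flagged [false], and the duplicate,
   flagged [true], which exists only for label [a]. *)
case/orP=> [/eqP<-|/andP[/eqP ca /eqP->]].
  by exists (exist _ (t, false) copy0).
have copy1 : (t, true).2 ==> (lab (t, true).1 == Some a) by rewrite /= lab_t ca.
by exists (exist _ (t, true) copy1).
Qed.

End Operations.

Theorem theorem7 (V : choiceType) (Sigma : eqType) (N1 N2 : lnet V Sigma)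
    (C1 C2 E : pform V) (a b : Sigma)
    (coh1 : coherent N1 C1) (coh2 : coherent N2 C2)
    (fvE : fvars E `<=` places N1 `|` places N2)
    (eqv : net_equiv E N1 C1 N2 C2) :
  [/\ (coherent (Tminus N1 a) C1 /\ coherent (Tplus N1 a b) C1) /\
      (coherent (Tminus N2 a) C2 /\ coherent (Tplus N2 a b) C2),
      net_equiv E (Tminus N1 a) C1 (Tminus N2 a) C2
    & net_equiv E (Tplus N1 a b) C1 (Tplus N2 a b) C2].
Proof.
have minus1 := @Tminus_relabel_by V Sigma N1 a.
have minus2 := @Tminus_relabel_by V Sigma N2 a.
have plus1 := @Tplus_relabel_by V Sigma N1 a b.
have plus2 := @Tplus_relabel_by V Sigma N2 a b.
split; first (split; split).
- exact: (coherent_relabel minus1 coh1).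
- exact: (coherent_relabel plus1 coh1).
- exact: (coherent_relabel minus2 coh2).
- exact: (coherent_relabel plus2 coh2).
- exact: (net_equiv_relabel minus1 minus2 eqv).
- exact: (net_equiv_relabel plus1 plus2 eqv).
Qed.
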